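(* Every first-countable $\omega$-well-filtered space with a countable underlying set is sober.
   Context: A set is countable if its cardinality is at most $\omega=|\mathbb N|$. For a $T_0$ space $X$, the specialization order is $x\le y$ iff $x\in\overline{\{y\}}$; a subset is saturated if it is an upper set in this order (equivalently, an intersection of open sets). $\mathsf{K}(X)$ is the set of all nonempty compact saturated subsets of $X$. A family $\mathcal K\subseteq\mathsf K(X)$ is filtered if it is nonempty and for all $K_1,K_2\in\mathcal K$ there is $K_3\in\mathcal K$ with $K_3\subseteq K_1\cap K_2$. A $T_0$ space $X$ is $\omega$-well-filtered if for every countable filtered family $\{K_i: i<\omega\}\subseteq\mathsf K(X)$ and every open $U\subseteq X$, $\bigcap_{i<\omega}K_i\subseteq U$ implies $K_{i_0}\subseteq U$ for some $i_0<\omega$. A nonempty set $A\subseteq X$ is irreducible if whenever $A\subseteq F_1\cup F_2$ with $F_1,F_2$ closed, then $A\subseteq F_1$ or $A\subseteq F_2$. $X$ is sober if every irreducible closed subset of $X$ is $\overline{\{a\}}$ for a unique $a\in X$. *)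

(* Defs.v *)
From mathcomp Require Import all_boot all_order all_algebra.
From mathcomp Require Import all_classical topology.

Set Implicit Arguments.
Unset Strict Implicit.
Unset Printing Implicit Defensive.

Local Open Scope classical_set_scope.

Section Defs.
Variable X : topologicalType.

Definition spec_le (x y : X) : Prop := closure [set y] x.

Definition saturated (A : set X) : Prop :=
  forall x y, A x -> spec_le x y -> A y.

(* The family K(X); the library's [compact] does not include Hausdorff
   separation, see [compact_cover]. *)
Definition compact_saturated : set (set X) :=
  [set K | [/\ K !=set0, compact K & saturated K]].

Definition filtered_family (F : set (set X)) : Prop :=
  F !=set0 /\
  forall K1 K2, F K1 -> F K2 -> exists2 K3, F K3 & K3 `<=` K1 `&` K2.

(* Repetitions are allowed among the [K i], so finite families are covered. *)
Definition omega_well_filtered : Prop :=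
  kolmogorov_space X /\
  forall K : nat -> set X,
    (forall i, compact_saturated (K i)) -> filtered_family (range K) ->
    forall U : set X, open U ->
      \bigcap_i K i `<=` U -> exists i0, K i0 `<=` U.

Definition irreducible (A : set X) : Prop :=
  A !=set0 /\
  forall F1 F2 : set X, closed F1 -> closed F2 ->
    A `<=` F1 `|` F2 -> A `<=` F1 \/ A `<=` F2.

Definition sober : Prop :=
  forall A : set X, closed A -> irreducible A ->
    exists! a : X, A = closure [set a].

Definition first_countable : Prop :=
  forall x : X, exists B : set (set X),
    [/\ countable B, B `<=` nbhs x &
        forall U, nbhs x U -> exists2 V, B V & V `<=` U].

End Defs.

Arguments omega_well_filtered : clear implicits.
Arguments sober : clear implicits.
Arguments first_countable : clear implicits.

(* Main.v *)
Require Import Defs.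
From mathcomp Require Import all_boot all_order all_algebra.
From mathcomp Require Import all_classical topology.

Local Open Scope classical_set_scope.

(* First countability and irreducibility give a sequence in the countable
   irreducible closed set A that converges to every point of A: its n-th term
   is taken in A and in the first n basic neighbourhoods of the first n points
   of A.  Since such a sequence converges to each of its own terms, the upper
   sets K n of its tails are compact.  They decrease and all meet A, so
   omega-well-filteredness yields a in A lying in every K n.  Thus a lies above
   infinitely many terms, hence in every neighbourhood of every point of A,
   and A is the closure of a. *)

Lemma spec_leP (X : topologicalType) (x y : X) :
  spec_le x y <-> forall U, nbhs x U -> U y.
Proof.
split=> [xy U /xy [_ [-> //]]|h U /h Uy].
by exists y.
Qed.

Lemma spec_le_refl (X : topologicalType) (x : X) : spec_le x x.
Proof. exact: subset_closure. Qed.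

Lemma spec_le_trans (X : topologicalType) (y x z : X) :
  spec_le x y -> spec_le y z -> spec_le x z.
Proof.
move=> /spec_leP xy /spec_leP yz; apply/spec_leP => U xU.
exact: yz (xy _ (nbhs_interior xU)).
Qed.

(** Points with equal closures lie below each other, so no neighbourhood separates them. This gives
    uniqueness of the generic point. *)
Lemma closure_set1_inj (X : topologicalType) :
  kolmogorov_space X -> injective (fun x : X => closure [set x]).
Proof.
move=> T0 x y /= xy; apply: contrapT => /eqP /T0 [U].
have /spec_leP xley : spec_le x y by rewrite /spec_le -xy; exact: spec_le_refl.
have /spec_leP ylex : spec_le y x by rewrite /spec_le xy; exact: spec_le_refl.
by rewrite !inE => -[[/xley]|[/ylex]].
Qed.

(** If [A] missed [U]&[V], the closed complements of [U] and [V] would cover [A]. *)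
Lemma irreducible_meetI {X : topologicalType} {A : set X} (U V : set X) :
  irreducible A -> open U -> open V ->
  A `&` U !=set0 -> A `&` V !=set0 -> A `&` (U `&` V) !=set0.
Proof.
move=> [_ irrA] oU oV [x [Ax Ux]] [y [Ay Vy]]; apply: contrapT => noUV.
case: (irrA (~` U) (~` V)); rewrite ?closedC//.
- move=> w Aw; apply: contrapT => /not_orP [/contrapT Uw /contrapT Vw].
  by apply: noUV; exists w.
- by move=> /(_ x Ax).
- by move=> /(_ y Ay).
Qed.

Lemma irreducible_meet_bigcap {X : topologicalType} {A : set X} {n : nat}
    (x : nat -> X) (U : nat -> set X) :
  irreducible A -> (forall i, A (x i)) -> (forall i, nbhs (x i) (U i)) ->
  exists2 z, A z & forall i, (i < n)%N -> U i z.
Proof.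
move=> irrA Ax xU.
suff [z [Az Uz]] : A `&` \big[setI/setT]_(i < n) (U i)° !=set0.
  exists z => // i ltin; apply: interior_subset.
  by move: Uz; rewrite -(bigcap_mkord _ (fun i => (U i)°)); apply.
have oI k : open (\big[setI/setT]_(i < k) (U i)°).
  by elim/big_ind: _ => [|? ?|i _]; [exact: openT|exact: openI|exact: open_interior].
elim: n => [|n IHn]; first by rewrite big_ord0 setIT; case: irrA.
rewrite big_ord_recr; apply: irreducible_meetI => //; first exact: open_interior.
by exists (x n); split => //; exact: xU.
Qed.

(** A countable base at [x] is nonempty, since it refines the whole space, so [nat] enumerates it,
    possibly with repetitions. *)
Lemma first_countable_seq (X : topologicalType) : first_countable X ->
  exists B : X -> nat -> set X, forall x,
    (forall i, nbhs x (B x i)) /\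
    (forall U, nbhs x U -> exists i, B x i `<=` U).
Proof.
move=> fcX.
suff /choice [B BP] (x : X) : exists B : nat -> set X,
    (forall i, nbhs x (B i)) /\ (forall U, nbhs x U -> exists i, B i `<=` U).
  by exists B.
have [B [cB Bx Bbase]] := fcX x.
have [B0|/unsquash f] := pfcard_geP cB.
  by have [V] := Bbase _ (@filterT _ _ (nbhs_filter x)); rewrite B0.
exists f; split => [i|U /Bbase [V BV VU]]; first by apply: Bx; exact: funS.
by have [i _ fi] := (@surj _ _ _ _ f) V BV; exists i; rewrite fi.
Qed.

Lemma irreducible_cvg_seq {X : topologicalType} {A : set X} :
  first_countable X -> irreducible A -> countable A ->
  exists2 z : nat -> X, (forall n, A (z n)) & (forall x, A x -> z @ \oo --> x).
Proof.
move=> /first_countable_seq [B Bbase] irrA cA.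
have [A0|/unsquash a] := pfcard_geP cA.
  by case: irrA => -[x]; rewrite A0.
have Aa i : A (a i) by exact: funS.
(* The sets [B (a m) i] need not decrease in [i], so the first [n] of them are intersected. *)
pose W n m := [set y | forall i : 'I_n, B (a m) i y].
have aW n m : nbhs (a m) (W n m).
  by apply: filter_forall => i; exact: (Bbase _).1.
have /choice [z Wz] n : exists z, A z /\ forall m, (m < n)%N -> W n m z.
  by have [z] := irreducible_meet_bigcap (n := n) _ _ irrA Aa (aW n); exists z.
exists z => [n|x Ax]; first exact: (Wz n).1.
have [m _ amx] := (@surj _ _ _ _ a) x Ax.
move=> U; rewrite -amx => /(Bbase _).2 [i BU].
(* Beyond this index, both the point [a m] and its neighbourhood [B (a m) i] are among the first [n]
   ones. *)
exists (maxn m i).+1 => // n /= ltn; apply: BU.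
have lti : (i < n)%N by exact: leq_ltn_trans (leq_maxr m i) ltn.
exact: (Wz n).2 m (leq_ltn_trans (leq_maxl m i) ltn) (Ordinal lti).
Qed.

Definition upper_tail {X : topologicalType} (z : nat -> X) (n : nat) : set X :=
  [set y | exists2 m, (n <= m)%N & spec_le (z m) y].

(** An open set around [z n] contains almost all terms, and finitely many more open sets catch the
    others. Open sets are upper sets, so they also catch every point above these terms. The proof
    states this for filters. *)
Lemma compact_saturated_upper_tail (X : topologicalType) (z : nat -> X) n :
  (forall m, z @ \oo --> z m) -> compact_saturated (upper_tail z n).
Proof.
move=> zz; split.
- by exists (z n), n => //; exact: spec_le_refl.
- move=> F PF FK; apply: contrapT => noK.
  have /choice [O OP] m : exists O : set X,
      (n <= m)%N -> nbhs (z m) O /\ F (~` O).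
    (* Terms before the tail are unconstrained, so [setT] is a dummy value. *)
    have [nm|] := boolP (n <= m)%N; last by exists setT.
    apply: contrapT => noO; apply: noK; exists (z m); split.
      by exists m => //; exact: spec_le_refl.
    move=> P Q FP zQ; apply: contrapT => PQ; apply: noO.
    exists Q => _; split => //; apply: filterS FP => w Pw Qw.
    by apply: PQ; exists w.
  have [znO FnO] := OP n (leqnn n).
  (* Passing to the interior makes [O n] a neighbourhood of each late term, so that it also contains
     the points above that term. *)
  have [N _ zO] := zz n _ (nbhs_interior znO).
  have FI : F [set y | forall m : 'I_N, (n <= m)%N -> ~ O m y].
    apply: filter_forall => m; have [nm|_] := boolP (n <= m)%N.
      by apply: filterS (OP m nm).2.
    exact: filterS filterT.
  apply: (@filter_not_empty _ F PF).
  apply: filterS (filterI FK (filterI FnO FI)).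
  move=> y [[m nm /spec_leP mley] [/= nOy nO]].
  have [Nm|mN] := leqP N m.
    exact: nOy (mley _ (zO m Nm)).
  exact: nO (Ordinal mN) nm (mley _ (OP m nm).1).
- move=> x y [m nm mlex] xley; exists m => //; exact: spec_le_trans mlex xley.
Qed.

Theorem corollary6p12 (X : topologicalType)
  (hfc : first_countable X) (hwf : omega_well_filtered X)
  (hcount : countable [set: X]) :
  sober X.
Proof.
move=> A cA irrA; case: hwf => T0 wf.
have cntA : countable A by exact: sub_countable (subset_card_le (@subsetT _ A)) hcount.
have [z Az zA] := irreducible_cvg_seq hfc irrA cntA.
have [a [Aa Ka]] : A `&` \bigcap_n upper_tail z n !=set0.
  apply: contrapT => noAK.
  have [n nA] : exists n, upper_tail z n `<=` ~` A.
    apply: wf.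
    - by move=> n; apply: compact_saturated_upper_tail => m; exact: zA.
    - split; first by exists (upper_tail z 0), 0%N.
      move=> _ _ [i _ <-] [j _ <-]; exists (upper_tail z (maxn i j)).
        by exists (maxn i j).
      by move=> y [m]; rewrite geq_max => /andP[im jm] my; split; exists m.
    - by rewrite openC.
    - by move=> y Ky Ay; apply: noAK; exists y.
  by apply: (nA (z n)) => //; exists n => //; exact: spec_le_refl.
have AE : A = closure [set a].
  apply/seteqP; split=> [x Ax|]; last first.
    by rewrite [X in _ `<=` X](closure_id A).1//; apply: closureS => _ ->.
  apply/spec_leP => U xU.
  have [N _ zU] := zA x Ax _ (nbhs_interior xU).
  have [m Nm /spec_leP zma] := Ka N I.
  exact: zma (zU m Nm).
by exists a; split => // b; rewrite AE => /(closure_set1_inj _ T0).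
Qed.
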